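(* Let $p$ be an odd prime and let $G$ be a finite $p$-group of class two with $G'=Z(G)$. Assume that there is no non-trivial $\mathrm{Aut}^c(G)$-equivariant homomorphism from $G/G'$ to $\mathrm{Aut}^c(G)$. Then $T(G)=\mathcal{S}\rtimes\mathcal{S}'$, that is, $T(G)$ is the internal semidirect product of its normal subgroup $\mathcal{S}$ and its subgroup $\mathcal{S}'$.
   Context: Maps are composed from left to right and written as exponents. For a group $G$: $S(G)$ is the group of permutations of the set $G$; $\rho:G\to S(G)$, $x^{\rho(y)}=xy$; $\mathrm{Hol}(G)=\mathrm{Aut}(G)\rho(G)$ is the normalizer of $\rho(G)$ in $S(G)$; $\mathrm{NHol}(G)$ is the normalizer of $\mathrm{Hol}(G)$ in $S(G)$; $T(G)=\mathrm{NHol}(G)/\mathrm{Hol}(G)$. $G'$ is the commutator subgroup and $Z(G)$ the center. $\mathrm{Aut}_c(G)$ and $\mathrm{Aut}^c(G)$ denote the kernel and the image of the natural homomorphism $\mathrm{Aut}(G)\to\mathrm{Aut}(G/Z(G))$. When $G'=Z(G)$, elements of $\mathrm{Aut}_c(G)$ act trivially on $G'$, so each $\alpha\in\mathrm{Aut}^c(G)$ determines a well-defined $\hat\alpha\in\mathrm{Aut}(G')$, the restriction to $G'$ of any lift of $\alpha$ to $\mathrm{Aut}(G)$. A homomorphism $\bar\gamma:G/G'\to\mathrm{Aut}^c(G)$ is $\mathrm{Aut}^c(G)$-equivariant if $\bar\gamma(v^\alpha)=\alpha^{-1}\bar\gamma(v)\alpha$ for all $v\in G/G'$, $\alpha\in\mathrm{Aut}^c(G)$.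 $B$ is the abelian group (under pointwise multiplication) of bilinear forms $\Delta:G/G'\times G/G'\to G'$ with $\Delta(u^\alpha,v^\alpha)=\Delta(u,v)^{\hat\alpha}$ for all $u,v\in G/G'$, $\alpha\in\mathrm{Aut}^c(G)$. $S$ (respectively $S'$) is the subgroup of those $\Delta\in B$ that are symmetric, $\Delta(u,v)=\Delta(v,u)$ (respectively anti-symmetric, $\Delta(u,v)=\Delta(v,u)^{-1}$), for all $u,v$. Each $\Delta\in B$ gives an anti-homomorphism $\gamma:G\to\mathrm{Aut}(G)$ by $x^{\gamma(y)}=x\,\Delta(xG',yG')$, and $N_\Delta=\{\gamma(x)\rho(x):x\in G\}$. Under the stated equivariance assumption, $\Delta\mapsto N_\Delta$ is a bijection from $B$ onto the set of normal regular subgroups of $\mathrm{Hol}(G)$; hence for each $\theta\mathrm{Hol}(G)\in T(G)$ there is a unique $\Delta_\theta\in B$ with $\rho(G)^\theta:=\theta^{-1}\rho(G)\theta=N_{\Delta_\theta}$ (depending only on the coset). Put $\mathcal{S}=\{\theta\mathrm{Hol}(G)\in T(G):\Delta_\theta\in S\}$ and $\mathcal{S}'=\{\theta\mathrm{Hol}(G)\in T(G):\Delta_\theta\in S'\}$. *)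

(* Defs.v *)
From mathcomp Require Import all_boot all_fingroup all_solvable.

Set Implicit Arguments.
Unset Strict Implicit.
Unset Printing Implicit Defensive.

Import GroupScope.

(* The group G is the full group [set: gT] of a finGroupType, so that the     *)
(* permutations of its underlying set are the elements of {perm gT}; these    *)
(* compose from left to right.                                                *)

Section Definitions.

Variable gT : finGroupType.

Local Notation G := [set: gT].
Local Notation Z := 'Z([set: gT]).

Definition rho : gT -> {perm gT} := actperm 'R.

Lemma rhoE y x : rho y x = x * y.
Proof. by rewrite /rho actpermE. Qed.

Definition rhoG : {set {perm gT}} := actperm 'R @* G.
Canonical rhoG_group := [group of rhoG].

Definition Hol : {set {perm gT}} := 'N(rhoG).
Canonical Hol_group := [group of Hol].

Lemma AutM a x y : a \in Aut G -> a (x * y) = a x * a y.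
Proof. by case/setIdP=> _ /morphicP->; rewrite ?inE. Qed.

Lemma HolE : Hol = Aut G * rhoG.
Proof.
have memR y : rho y \in rhoG by apply: mem_morphim; rewrite inE.
have rhoP s : s \in rhoG -> exists y, s = rho y.
  by case/morphimP=> y _ _ ->; exists y.
apply/setP=> s; apply/idP/idP => [Ns | /mulsgP[a r Aa Rr ->]]; last first.
  rewrite groupM ?(subsetP (normG rhoG) r Rr) //.
  rewrite inE; apply/subsetP=> _ /imsetP[_ /rhoP[y ->] ->].
  have -> : rho y ^ a = rho (a y); last exact: memR.
  by apply/permP=> x; rewrite rhoE /conjg !permM rhoE AutM // permKV.
pose a := s * (rho (s 1))^-1.
have -> : s = a * rho (s 1) by rewrite mulgKV.
apply: mem_mulg; last exact: memR.
have Na : a \in 'N(rhoG).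
  by rewrite groupM // groupV (subsetP (normG rhoG)) ?memR.
have a1 : a 1 = 1.
  by apply: (@perm_inj _ (rho (s 1))); rewrite -permM mulgKV rhoE mul1g.
rewrite inE; apply/andP; split; first by apply/subsetP=> x; rewrite inE.
apply/morphicP=> x y _ _.
have [z ez] : exists z, rho y ^ a = rho z by apply: rhoP; rewrite memJ_norm.
have eqz w : a (w * y) = a w * z.
  by rewrite -[w * y]rhoE -[RHS]rhoE -ez -!permM -conjgC.
by rewrite eqz; have := eqz 1; rewrite a1 !mul1g => ->.
Qed.

Definition NHol : {set {perm gT}} := 'N(Hol).
Canonical NHol_group := [group of NHol].

Definition T : {set coset_of Hol} := NHol / Hol.
Canonical T_group := [group of T].

(* From here on the intended hypothesis is G' = Z(G).  Then G/G' and G/Z(G)   *)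
(* are the same quotient, and the single type coset_of 'Z(G) is used for      *)
(* both, so that the elements of Aut^c(G) act on G/G'.                        *)

Local Notation V := (coset_of Z).

Definition natAut : {perm gT} -> {perm V} := actperm ([Aut G] / Z).

Lemma norm_center x : x \in 'N(Z).
Proof. by rewrite (subsetP (normal_norm (center_normal G))) ?inE. Qed.

Lemma Aut_char (H : {group gT}) a x :
  H \char G -> a \in Aut G -> x \in H -> a x \in H.
Proof.
move=> /charP[_ chH] Aa Hx.
have <- : autm Aa @* H = H by apply: chH; rewrite ?injm_autm ?im_autm.
by rewrite -(autmE Aa) mem_morphim ?inE.
Qed.

Lemma qact_dom_Aut : qact_dom [Aut G] Z = Aut G.
Proof.
rewrite qact_domE ?subsetT //; apply/eqP; rewrite eqEsubset subsetIl /=.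
apply/subsetP=> a Aa; rewrite inE Aa inE; apply/subsetP=> x Zx.
by rewrite inE /= /autact /= Aut_char ?center_char.
Qed.

Lemma natAutE a x : a \in Aut G -> natAut a (coset Z x) = coset Z (a x).
Proof.
move=> Aa; rewrite /natAut actpermE qactE ?qact_dom_Aut ?norm_center //=.
Qed.

Definition AutC : {set {perm V}} := actperm ([Aut G] / Z) @* Aut G.
Canonical AutC_group := [group of AutC].

Lemma AutCE : AutC = natAut @: Aut G.
Proof. by apply: morphimEsub; rewrite /= qact_dom_Aut. Qed.

Lemma AutC_sub : AutC \subset Aut (G / Z).
Proof.
rewrite AutCE; apply/subsetP=> _ /imsetP[a Aa ->].
have onto (u : V) : exists x, u = coset Z x.
  by case: (cosetP u) => x _ ->; exists x.
have cM x y : coset Z (x * y) = coset Z x * coset Z y.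
  by rewrite morphM ?norm_center.
rewrite inE; apply/andP; split.
  by apply/subsetP=> u _; have [x ->] := onto u; rewrite mem_quotient ?inE.
apply/morphicP=> u v _ _; have [x ->] := onto u; have [y ->] := onto v.
by rewrite -cM !natAutE // -cM AutM.
Qed.

Definition equivariant (g : V -> {perm V}) : Prop :=
  forall (v : V) (alpha : {perm V}),
    alpha \in AutC -> g (alpha v) = g v ^ alpha.

(* The lift is chosen arbitrarily; by hatE any lift gives the same result.    *)
Definition hat (alpha : {perm V}) : {perm gT} :=
  restr_perm G^`(1)
    (odflt 1 [pick a | (a \in Aut G) && (natAut a == alpha)]).

Lemma hatE (a : {perm gT}) (z : gT) :
  a \in Aut G -> z \in G^`(1) -> hat (natAut a) z = a z.
Proof.
move=> Aa Gz; rewrite /hat; case: pickP => [b | /(_ a)];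
  last by rewrite Aa eqxx.
move=> /andP[Ab /eqP eab].
have derA c : c \in Aut G -> {in G^`(1), forall w, c w \in G^`(1)}.
  by move=> Ac w; apply: Aut_char; rewrite ?der_char.
rewrite /= restr_permE //; last first.
  by rewrite !inE /=; apply/subsetP=> x Gx; rewrite inE /= /aperm derA.
have sub : G^`(1) \subset [set x | b x == a x].
  have gs : group_set [set x | b x == a x].
    apply/group_setP; split=> [|x y]; rewrite !inE.
      by rewrite -(autmE Ab) -(autmE Aa) !morph1.
    by move=> /eqP ex /eqP ey; rewrite !AutM // ex ey.
  rewrite derg1 /commutator (gen_subG _ (Group gs)).
  apply/subsetP=> _ /imset2P[x y _ _ ->].
  have cen w : exists2 c, c \in Z & b w = c * a w.
    have := natAutE w Ab; rewrite eab natAutE // => /esym ew.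
    have /rcosetP[c Zc ec] : b w \in Z :* a w.
      by apply/rcoset_kercosetP; rewrite ?norm_center.
    by exists c.
  have cR e : e \in Aut G -> e [~ x, y] = [~ e x, e y].
    by move=> Ae; rewrite -!(autmE Ae) morphR ?inE.
  rewrite inE !cR //; have [c Zc ->] := cen x.
  have [d Zd ->] := cen y.
  have cc v w : v \in Z -> [~ v, w] = 1.
    by case/centerP=> _ cv; apply/eqP/commgP/cv; rewrite inE.
  have cc' v w : v \in Z -> [~ w, v] = 1.
    by move=> Zv; rewrite -invg_comm cc ?invg1.
  by rewrite commMgJ (cc c) // conj1g mul1g commgMJ (cc' d) // conj1g mulg1.
by have := subsetP sub z Gz; rewrite inE => /eqP.
Qed.

Definition form := {ffun V * V -> gT}.

Definition is_bilinear (D : form) : bool :=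
  [&& [forall u : V, forall v : V, D (u, v) \in G^`(1)],
      [forall u : V, forall u' : V, forall v : V,
         D (u * u', v) == D (u, v) * D (u', v)]
    & [forall u : V, forall v : V, forall v' : V,
         D (u, v * v') == D (u, v) * D (u, v')]].

Definition Bforms : {set form} :=
  [set D : form | is_bilinear D &&
    [forall alpha in AutC, forall u : V, forall v : V,
       D (alpha u, alpha v) == hat alpha (D (u, v))]].

Definition Sforms : {set form} :=
  [set D in Bforms | [forall u : V, forall v : V, D (u, v) == D (v, u)]].

Definition S'forms : {set form} :=
  [set D in Bforms | [forall u : V, forall v : V, D (u, v) == (D (v, u))^-1]].

(* The default permutation 1 is never used when D \in Bforms and G' is        *)
(* contained in Z(G), see gammaE.                                             *)
Definition gamma (D : form) (y : gT) : {perm gT} :=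
  insubd (1 : {perm gT}) [ffun x : gT => x * D (coset Z x, coset Z y)].

Lemma gammaE (D : form) (x y : gT) :
    G^`(1) \subset Z -> D \in Bforms ->
  gamma D y x = x * D (coset Z x, coset Z y).
Proof.
move=> sGZ /setIdP[/and3P[/forallP Dv _ _] _].
have Zc u v : D (u, v) \in Z by apply: (subsetP sGZ); have /forallP := Dv u.
pose f := [ffun x : gT => x * D (coset Z x, coset Z y)].
have inj : injectiveb f.
  apply/injectiveP=> v w; rewrite !ffunE => e.
  have evw : coset Z v = coset Z w.
    have := congr1 (coset Z) e; rewrite !morphM ?norm_center //=.
    by rewrite ![coset _ (D _)]coset_id ?mulg1.
  by move: e; rewrite evw => /mulIg.
have e : val (gamma D y) = f by rewrite /gamma insubdK.
by rewrite -pvalE e ffunE.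
Qed.

Definition Nform (D : form) : {set {perm gT}} :=
  [set gamma D x * rho x | x in G].

Lemma Nform_inj :
  G^`(1) \subset Z -> {in Bforms &, injective Nform}.
Proof.
move=> sGZ D E BD BE eN; apply/ffunP=> -[u v].
have [x _ ->] := cosetP u; have [y _ ->] := cosetP v.
have one F w : F \in Bforms -> F (1, w) = 1.
  case/setIdP=> /and3P[_ /forallP/(_ 1)/forallP/(_ 1)/forallP/(_ w)/eqP e _] _.
  by apply: (mulgI (F (1, w))); rewrite -e !mulg1.
have val F z w : F \in Bforms ->
    (gamma F z * rho z) w = w * F (coset Z w, coset Z z) * z.
  by move=> BF; rewrite permM rhoE gammaE.
have : gamma D y * rho y \in Nform E by rewrite -eN; apply/imsetP; exists y; rewrite ?inE.
case/imsetP=> z _ e; have ezy : y = z.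
  have := congr1 (fun s : {perm gT} => s 1) e.
  by rewrite !val // !morph1 !one // !mul1g.
have := congr1 (fun s : {perm gT} => s x) e.
by rewrite !val // -ezy => /mulIg/mulgI.
Qed.

(* By Nform_inj there is at most one choice.                                  *)
Definition Delta (theta : {perm gT}) : option form :=
  [pick D in Bforms | rhoG :^ theta == Nform D].

Definition calS : {set coset_of Hol} :=
  [set coset Hol theta | theta in NHol & oapp (mem Sforms) false (Delta theta)].

Definition calS' : {set coset_of Hol} :=
  [set coset Hol theta | theta in NHol & oapp (mem S'forms) false (Delta theta)].

End Definitions.

Arguments T gT : clear implicits.
Arguments calS gT : clear implicits.
Arguments calS' gT : clear implicits.
Arguments AutC gT : clear implicits.

(* Main.v *)
Require Import Defs.
From mathcomp Require Import all_boot all_fingroup all_solvable.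

Import GroupScope.

(** Every coset of Hol(G) in NHol(G) has a representative t fixing 1, and such
    a t is measured by its defect, t (x * y) = t x * t y * defect t x y.  The
    equivariance assumption forces the defect to be
    Delta_t (t x) (t y), with Delta_t a bilinear form with values in Z(G), and
    membership in calS or calS' says that the defect is symmetric or
    antisymmetric.

    Why the defect is a form: the regular group rho(G)^t lies in Hol(G), so
    its element sending 1 to w is g w * rho w with g w an automorphism.
    Normality in Hol(G) makes g an Aut(G)-equivariant antihomomorphism
    (NHol_twisting).  Equivariance under inner automorphisms makes the image
    of g in Aut^c(G) commutative, hence g induces an equivariant homomorphism
    from G/G' to Aut^c(G), which is trivial by assumption: each g w is a
    central automorphism x |-> x * e x w, and e is the form
    (equivariant_antimorph_central).

    The defect is a cocycle (defect_comp): the defect of t * s, maps composed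
    from left to right, is the defect of s at the images under t, times the
    image under s of the defect of t.  So calS and calS' are closed under
    products.  Their intersection is trivial because a form that is both
    symmetric and antisymmetric has square 1, and |G| is odd.

    The remaining ingredient is that a form e can be integrated: the map
    x |-> x * e x x ^+ k lies in NHol(G), acts trivially on Z(G) and on
    G/Z(G), and has defect (e x y * e y x) ^+ k (quadratic_twist).  As |G| is
    odd, k can be chosen to act as 1/2 or as -1/2.
    With 1/2, this represents each element of calS by a map trivial on Z(G)
    and G/Z(G); conjugation by s carries the defect of such a map to its image
    under s, still symmetric, so calS is normal (calS_norm).  With -1/2, it
    cancels the symmetric part of the defect of an arbitrary element of T(G),
    leaving an antisymmetric one, so T(G) = calS' calS (T_decomp). *)

Section Forms.

Set Implicit Arguments.
Unset Strict Implicit.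

Variable gT : finGroupType.

Local Notation G := [set: gT].
Local Notation Z := 'Z([set: gT]).
Local Notation V := (coset_of Z).
Local Notation cosetZ := (coset 'Z([set: gT])).

(** * Central cosets and the holomorph *)

(** Stated for bare functions, so that it applies directly to each variable of
    a bilinear map and to maps read modulo the center. *)
Lemma der1_hom_commuting (aT rT : finGroupType) (f : aT -> rT) :
    {morph f : x y / x * y} -> (forall x y, commute (f x) (f y)) ->
  forall z, z \in [set: aT]^`(1) -> f z = 1.
Proof.
move=> fM fC z; have f1 : f 1 = 1 by apply: (mulgI (f 1)); rewrite -fM !mulg1.
have gs : group_set [set x | f x == 1].
  apply/group_setP; split=> [|x y]; rewrite !inE ?f1 //.
  by rewrite fM => /eqP-> /eqP->; rewrite mulg1.
have sub : [set: aT]^`(1) \subset [set x | f x == 1].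
  rewrite derg1 /commutator (gen_subG _ (Group gs)).
  apply/subsetP=> _ /imset2P[x y _ _ ->]; rewrite inE /=.
  have := fM x y; rewrite commgC !fM fC -[LHS]mulgA => /mulgI/eqP.
  by rewrite -[X in _ == X -> _]mulg1 (inj_eq (mulgI _)).
by move/(subsetP sub); rewrite inE => /eqP.
Qed.

Lemma centralC z x : z \in Z -> z * x = x * z.
Proof. by case/centerP=> _; apply; rewrite inE. Qed.

Lemma cosetZ_onto (u : V) : exists x, u = cosetZ x.
Proof. by case: (cosetP u) => x _ ->; exists x. Qed.

Lemma cosetZM x y : cosetZ (x * y) = cosetZ x * cosetZ y.
Proof. by rewrite morphM ?norm_center. Qed.

Lemma cosetZMr x z : z \in Z -> cosetZ (x * z) = cosetZ x.
Proof. by move=> Zz; rewrite cosetZM (coset_id Zz) mulg1. Qed.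

Lemma repr_cosetZ x : exists2 z, z \in Z & repr (cosetZ x) = x * z.
Proof.
have /rcosetP[z Zz ->] : repr (cosetZ x) \in Z :* x.
  by apply/rcoset_kercosetP; rewrite ?norm_center ?coset_reprK.
by exists z => //; apply: centralC.
Qed.

Lemma mem_rho y : rho y \in rhoG gT.
Proof. by apply: mem_morphim; rewrite inE. Qed.

Lemma rhoGP s : s \in rhoG gT -> exists y, s = rho y.
Proof. by case/morphimP=> y _ _ ->; exists y. Qed.

Lemma rhoM x y : rho (x * y) = rho x * rho y :> {perm gT}.
Proof. by apply/permP=> w; rewrite permM !rhoE mulgA. Qed.

Lemma rho_Hol y : rho y \in Hol gT.
Proof. exact: subsetP (normG _) _ (mem_rho y). Qed.

Lemma rho_conj_Aut a y : a \in Aut G -> rho y ^ a = rho (a y).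
Proof.
by move=> Aa; apply/permP=> x; rewrite rhoE /conjg !permM rhoE AutM // permKV.
Qed.

Lemma Aut_Hol a : a \in Aut G -> a \in Hol gT.
Proof.
by move=> Aa; rewrite HolE -[a]mulg1 mem_mulg ?group1.
Qed.

Lemma Hol_fix1_Aut s : s \in Hol gT -> s 1 = 1 -> s \in Aut G.
Proof.
rewrite HolE => /mulsgP[a _ Aa /rhoGP[y ->] ->].
rewrite permM rhoE -(autmE Aa) morph1 mul1g => ->.
by rewrite /rho morph1 mulg1.
Qed.

Lemma perm_AutM (a : {perm gT}) : {morph a : x y / x * y} -> a \in Aut G.
Proof.
move=> aM; rewrite inE; apply/andP; split; first by apply/subsetP=> x; rewrite inE.
by apply/morphicP=> x y _ _.
Qed.

(** * Equivariant bilinear forms on G *)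

(** The forms of B, pulled back from G/G' to G: when G' = Z(G), bilinearity
    already makes them vanish on the center (equi_centerl, equi_centerr), and
    Aut^c(G) can be replaced by Aut(G). *)
Record equiform (e : gT -> gT -> gT) : Prop := Equiform {
  equi_center : forall x y, e x y \in Z;
  equiMl : forall x x' y, e (x * x') y = e x y * e x' y;
  equiMr : forall x y y', e x (y * y') = e x y * e x y';
  equi_Aut : forall a x y, a \in Aut G -> e (a x) (a y) = a (e x y) }.

Hypothesis derZ : G^`(1) = Z.

Lemma equi_commute e : equiform e -> forall x y x' y',
  commute (e x y) (e x' y').
Proof. by move=> Fe x y x' y'; apply/centralC/(equi_center Fe). Qed.

(** A homomorphism into the abelian group Z(G) kills G' = Z(G). *)
Lemma equi_centerl e z y : equiform e -> z \in Z -> e z y = 1.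
Proof.
move=> Fe; rewrite -derZ; apply: (@der1_hom_commuting _ _ (e^~ y)).
  by move=> x x'; rewrite (equiMl Fe).
by move=> x x'; apply: equi_commute.
Qed.

Lemma equi_centerr e z x : equiform e -> z \in Z -> e x z = 1.
Proof.
move=> Fe; rewrite -derZ; apply: der1_hom_commuting.
  by move=> y y'; rewrite (equiMr Fe).
by move=> y y'; apply: equi_commute.
Qed.

Lemma equi_modl e x y z : equiform e -> z \in Z -> e (x * z) y = e x y.
Proof. by move=> Fe Zz; rewrite (equiMl Fe) (equi_centerl _ Fe Zz) mulg1. Qed.

Lemma equi_modr e x y z : equiform e -> z \in Z -> e x (y * z) = e x y.
Proof. by move=> Fe Zz; rewrite (equiMr Fe) (equi_centerr _ Fe Zz) mulg1. Qed.

(** Written additively this is k times e plus its transpose, so that when k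
    acts as 1/2 or -1/2 it is the symmetric part of e, up to sign. *)
Lemma equiform_symX e k :
  equiform e -> equiform (fun x y => (e x y * e y x) ^+ k).
Proof.
move=> Fe; have Ml x x' y :
    (e (x * x') y * e y (x * x')) ^+ k =
    (e x y * e y x) ^+ k * (e x' y * e y x') ^+ k.
  rewrite (equiMl Fe) (equiMr Fe) -expgMn; last first.
    by apply/centralC; rewrite groupM ?(equi_center Fe).
  congr (_ ^+ k); rewrite -!mulgA; congr (_ * _).
  by rewrite !mulgA; congr (_ * _); apply: equi_commute.
have sC x y : (e x y * e y x) ^+ k = (e y x * e x y) ^+ k.
  by congr (_ ^+ k); apply: equi_commute.
split=> [x y | // | x y y' | a x y Aa].
- by rewrite groupX ?groupM ?(equi_center Fe).
- by rewrite sC Ml !(sC x).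
- by rewrite !(equi_Aut Fe) // -AutM // -!(autmE Aa) morphX ?inE.
Qed.

Lemma equiform_Bforms e : equiform e ->
  exists2 D, D \in Bforms gT & forall x y, D (cosetZ x, cosetZ y) = e x y.
Proof.
move=> Fe; pose D : form gT := [ffun w : V * V => e (repr w.1) (repr w.2)].
have DE x y : D (cosetZ x, cosetZ y) = e x y.
  rewrite ffunE /=; have [z Zz ->] := repr_cosetZ x.
  have [w Zw ->] := repr_cosetZ y.
  by rewrite (equi_modl _ _ Fe) ?(equi_modr _ _ Fe).
exists D => //; rewrite inE; apply/andP; split.
  apply/and3P; split; apply/forallP=> u; apply/forallP=> v.
  - have [x ->] := cosetZ_onto u; have [y ->] := cosetZ_onto v.
    by rewrite DE derZ (equi_center Fe).
  - apply/forallP=> w; have [x ->] := cosetZ_onto u.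
    have [y ->] := cosetZ_onto v; have [t ->] := cosetZ_onto w.
    by rewrite -cosetZM !DE (equiMl Fe).
  - apply/forallP=> w; have [x ->] := cosetZ_onto u.
    have [y ->] := cosetZ_onto v; have [t ->] := cosetZ_onto w.
    by rewrite -cosetZM !DE (equiMr Fe).
apply/forall_inP=> al; rewrite AutCE => /imsetP[a Aa ->].
apply/forallP=> u; apply/forallP=> v.
have [x ->] := cosetZ_onto u; have [y ->] := cosetZ_onto v.
by rewrite !natAutE // !DE hatE ?(equi_Aut Fe) // derZ (equi_center Fe).
Qed.

(** * Permutations that are bilinear up to a form *)

Definition defect (t : {perm gT}) x y := (t x * t y)^-1 * t (x * y).

Lemma defectE (t : {perm gT}) x y : t (x * y) = t x * t y * defect t x y.
Proof. by rewrite mulKVg. Qed.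

(** The permutation t is an isomorphism from G onto the group with product
    x * y * e x y; hence the form is evaluated at the images t x and t y. *)
Definition twists (e : gT -> gT -> gT) (t : {perm gT}) :=
  forall x y, t (x * y) = t x * t y * e (t x) (t y).

Lemma defect_twists e (t : {perm gT}) x y :
  twists e t -> defect t x y = e (t x) (t y).
Proof. by move=> te; rewrite /defect te mulKg. Qed.

(** Conjugation by t turns right translation by y into the right translation
    by t y of the twisted product, which is gamma D (t y) * rho (t y). *)
Lemma Nform_twists D (t : {perm gT}) :
    D \in Bforms gT -> twists (fun x y => D (cosetZ x, cosetZ y)) t ->
  rhoG gT :^ t = Nform D.
Proof.
move=> BD te; have sGZ : G^`(1) \subset Z by rewrite derZ.
have eR y : rho y ^ t = gamma D (t y) * rho (t y).
  apply/permP=> x; rewrite -[x](permKV t) permJ !permM !rhoE gammaE //.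
  rewrite te -!mulgA; congr (_ * _); apply/esym/centralC.
  case/setIdP: BD => /and3P[/forallP/(_ (cosetZ (t (t^-1 x)))) /forallP H _ _] _.
  exact: subsetP sGZ _ (H _).
apply/setP=> s; apply/imsetP/imsetP=> [[_ /rhoGP[y ->] ->] | [w _ ->]].
  by exists (t y); rewrite ?inE.
by exists (rho (t^-1 w)); rewrite ?mem_rho // eR permKV.
Qed.

Definition twisting (t : {perm gT}) := exists2 e, equiform e & twists e t.

Lemma twisting_defectZ t x y : twisting t -> defect t x y \in Z.
Proof. by case=> e Fe te; rewrite (defect_twists _ _ te) (equi_center Fe). Qed.

(** Modulo Z(G), t is a homomorphism to the abelian group G/G', so it kills
    G' = Z(G). *)
Lemma twisting_center t z : twisting t -> z \in Z -> t z \in Z.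
Proof.
move=> Tt; have dZ x y := twisting_defectZ x y Tt; rewrite -{1}derZ => Gz.
suff: cosetZ (t z) = 1 by move/coset_idr; apply; apply: norm_center.
apply: (der1_hom_commuting (f := fun x => cosetZ (t x))) Gz => [x y | x y].
  by rewrite defectE cosetZMr // cosetZM.
rewrite /commute -!cosetZM commgC (cosetZMr (t y * t x)) //.
by rewrite -derZ mem_commg ?inE.
Qed.

Lemma twistingMr t x z : twisting t -> z \in Z -> t (x * z) = t x * t z.
Proof.
move=> Tt Zz; have Ztz := twisting_center Tt Zz; case: Tt => e Fe te.
by rewrite te (equi_centerr _ Fe Ztz) mulg1.
Qed.

Lemma twisting1 t : twisting t -> t 1 = 1.
Proof.
by move=> Tt; apply: (mulgI (t 1)); rewrite -twistingMr ?group1 // !mulg1.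
Qed.

Lemma twistingV t z : twisting t -> z \in Z -> t z^-1 = (t z)^-1.
Proof.
move=> Tt Zz; apply: (mulIg (t z)).
by rewrite -twistingMr // !mulVg twisting1.
Qed.

(** The defect is the form read through t, and t is a homomorphism modulo the
    center. *)
Lemma twisting_defect_mod t x y z w : twisting t -> z \in Z -> w \in Z ->
  defect t (x * z) (y * w) = defect t x y.
Proof.
move=> Tt Zz Zw.
have [Ztz Ztw] := (twisting_center Tt Zz, twisting_center Tt Zw).
have [txz tyw] := (twistingMr x Tt Zz, twistingMr y Tt Zw).
case: Tt => e Fe te; rewrite !(defect_twists _ _ te) txz tyw.
by rewrite (equi_modl _ _ Fe) // (equi_modr _ _ Fe).
Qed.

(** The cocycle rule: s is multiplicative against the central value
    defect t x y. *)
Lemma defect_comp t s x y : twisting t -> twisting s ->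
  defect (t * s) x y = defect s (t x) (t y) * s (defect t x y).
Proof.
move=> Tt Ts; rewrite {1}/defect !permM defectE twistingMr ?twisting_defectZ //.
by rewrite (defectE s) -(mulgA (s (t x) * s (t y))) mulKg.
Qed.

Lemma defect_eq1_Aut (t : {perm gT}) :
  (forall x y, defect t x y = 1) -> t \in Aut G.
Proof. by move=> d1; apply: perm_AutM => x y; rewrite defectE d1 mulg1. Qed.

(** Integration of a form.  The quadratic map x |-> e x x has polarization
    e x y * e y x, so multiplying the identity by its k-th power produces the
    stated defect.  The map normalizes Hol(G) = Aut(G) rho(G) because it
    commutes with Aut(G), by equivariance of e, and conjugates rho y to the
    product of the central automorphism w |-> w * (e w y * e y w) ^+ k and the
    translation by t y. *)
Lemma quadratic_twist e k : equiform e -> exists t : {perm gT},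
  [/\ t \in NHol gT, twisting t,
      forall x, exists2 z, z \in Z & t x = x * z,
      {in Z, forall z, t z = z}
    & forall x y, defect t x y = (e x y * e y x) ^+ k].
Proof.
move=> Fe; have eC := equi_commute Fe.
have eZ x y j : e x y ^+ j \in Z by rewrite groupX ?(equi_center Fe).
pose q x := x * e x x ^+ k.
(* e x x depends on x modulo Z only, and q does not move x modulo Z. *)
have q_inj : injective q.
  move=> x y exy; have ey : y = x * (e x x ^+ k * (e y y ^+ k)^-1).
    by rewrite mulgA -[x * _]/(q x) exy mulgK.
  have Zxy : e x x ^+ k * (e y y ^+ k)^-1 \in Z by rewrite groupM ?groupV.
  move: exy; rewrite /q; suff -> : e x x = e y y by apply: mulIg.
  by rewrite ey (equi_modl _ _ Fe) ?(equi_modr _ _ Fe) // -?ey.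
pose t := perm q_inj; have tE x : t x = x * e x x ^+ k by rewrite permE.
have tM x y : t (x * y) = t x * t y * (e x y * e y x) ^+ k.
  rewrite !tE (equiMl Fe) !(equiMr Fe) !expgMn; try exact: eC; last first.
    by apply/centralC; rewrite groupM ?(equi_center Fe).
  rewrite -!mulgA; congr (x * _).
  rewrite [LHS]mulgA -(centralC y (eZ x x k)) -mulgA.
  by congr (_ * (y * _)); rewrite mulgA [RHS]centralC.
have tl x y : e (t x) y = e x y by rewrite tE (equi_modl _ _ Fe).
have tr x y : e x (t y) = e x y by rewrite tE (equi_modr _ _ Fe).
have defE x y : defect t x y = (e x y * e y x) ^+ k by rewrite /defect tM mulKg.
have Ff := equiform_symX k Fe.
have Tt : twisting t.
  by exists (fun x y => (e x y * e y x) ^+ k) => // x y; rewrite tM !tl !tr.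
exists t; split=> //; last first.
- by move=> z Zz; rewrite tE (equi_centerl _ Fe) // expg1n mulg1.
- by move=> x; exists (e x x ^+ k).
  have tAut a : a \in Aut G -> a ^ t = a.
    move=> Aa; apply: (mulgI t); rewrite -conjgC; apply/permP=> x.
    by rewrite !permM !tE AutM // (equi_Aut Fe) // -!(autmE Aa) morphX ?inE.
  rewrite inE; apply/subsetP=> _ /imsetP[h Hh ->].
  have /mulsgP[a _ Aa /rhoGP[y ->] ->] : h \in Aut G * rhoG gT by rewrite -HolE.
  rewrite conjMg tAut //.
  apply: (@groupM _ (Hol_group gT)); first exact: Aut_Hol.
  have -> : rho y ^ t = rho y ^ t * (rho (t y))^-1 * rho (t y) by rewrite mulgKV.
  apply: (@groupM _ (Hol_group gT)); last exact: rho_Hol.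
  suff /Aut_Hol: rho y ^ t * (rho (t y))^-1 \in Aut G by [].
  apply: perm_AutM => x x'.
  have cE w : (rho y ^ t * (rho (t y))^-1) w = w * (e w y * e y w) ^+ k.
    apply: (@perm_inj _ (rho (t y))); rewrite -permM mulgKV rhoE.
    rewrite -[w](permKV t) permJ rhoE tM -!mulgA; congr (_ * _).
    by rewrite tl tr; apply/esym/centralC/(equi_center Ff).
  rewrite !cE (equiMl Ff) -!mulgA; congr (x * _); rewrite !mulgA; congr (_ * _).
  by apply/esym/centralC/(equi_center Ff).
Qed.

(** * Representatives in NHol(G) have bilinear defect *)

Lemma translate_Hol (t : {perm gT}) y : t \in NHol gT -> rho y ^ t \in Hol gT.
Proof. by move=> Nt; rewrite memJ_norm ?rho_Hol. Qed.

Section Existence.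

Hypothesis no_equiv : forall g : {morphism (G / Z) >-> {perm V}},
  g @* (G / Z) \subset AutC gT -> equivariant g -> forall v : V, g v = 1.

(** Conjugating x by y does not change the image of g x in Aut^c(G), since
    inner automorphisms act trivially on the abelian group G/Z(G).  So these
    images commute, and the antihomomorphism induced by g is a homomorphism
    that factors through G/G', to which the assumption applies. *)
Lemma equivariant_antimorph_central (g : gT -> {perm gT}) :
    (forall x, g x \in Aut G) ->
    (forall x y, g (x * y) = g y * g x) ->
    (forall a x, a \in Aut G -> g (a x) = g x ^ a) ->
  forall x y, x^-1 * g y x \in Z.
Proof.
move=> gA gM gJ; pose h x := natAut (g x).
have natM a b : a \in Aut G -> b \in Aut G ->
  natAut (a * b) = natAut a * natAut b.
  move=> Aa Ab; apply/permP=> u; have [x ->] := cosetZ_onto u.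
  by rewrite permM !natAutE ?groupM // permM.
have natJ a b : a \in Aut G -> b \in Aut G ->
  natAut (a ^ b) = natAut a ^ natAut b.
  move=> Aa Ab; apply: (mulgI (natAut b)).
  by rewrite -conjgC -!natM ?groupJ // -conjgC.
have hJ x y : h (x ^ y) = h x.
  have Ay : conj_aut G y \in Aut G by apply: Aut_aut.
  have cE w : conj_aut G y w = w ^ y.
    by rewrite norm_conj_autE ?inE //; apply/subsetP=> v; rewrite !inE.
  rewrite -cE /h gJ // natJ // /conjg.
  have -> : natAut (conj_aut G y) = 1; last by rewrite invg1 mul1g mulg1.
  apply/permP=> u; have [w ->] := cosetZ_onto u.
  by rewrite perm1 natAutE // cE conjg_mulR cosetZMr // -derZ mem_commg ?inE.
have hM' x y : h (x * y) = h y * h x by rewrite /h gM natM.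
have hC x y : commute (h x) (h y).
  by rewrite /commute -hM' conjgC hM' hJ.
have hM : {morph h : x y / x * y} by move=> x y; rewrite hM' hC.
have h1 z : z \in Z -> h z = 1.
  by move=> Zz; apply: (der1_hom_commuting hM hC); rewrite derZ.
have hr x : h (repr (cosetZ x)) = h x.
  by have [z Zz ->] := repr_cosetZ x; rewrite hM (h1 z) ?mulg1.
pose f (u : V) := h (repr u).
have fM : {in G / Z &, {morph f : u v / u * v}}.
  move=> u v _ _; have [x ->] := cosetZ_onto u; have [y ->] := cosetZ_onto v.
  by rewrite -cosetZM /f !hr.
have f1 := no_equiv (g := Morphism fM).
have {f1 hr} h1' y : h y = 1.
  rewrite -hr; apply: f1.
    apply/subsetP=> _ /morphimP[u _ _ ->] /=.
    by rewrite AutCE; apply/imsetP; exists (g (repr u)).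
  move=> u al; rewrite AutCE => /imsetP[a Aa ->] /=.
  have [x ->] := cosetZ_onto u; rewrite natAutE // /f !hr /h gJ //.
  exact: natJ.
move=> x y; have /permP/(_ (cosetZ x)) := h1' y.
rewrite perm1 /h natAutE // => /rcoset_kercosetP; rewrite !norm_center.
case/(_ isT isT)/rcosetP=> z Zz ->.
by rewrite centralC // mulKg.
Qed.

(** Here n w is the element of the regular group rho(G)^t that sends 1 to w,
    and g w its automorphism part.  The product in this group gives gn;
    its normality in Hol(G) gives gJ; together they make g an
    antihomomorphism. *)
Lemma NHol_twisting (t : {perm gT}) : t \in NHol gT -> t 1 = 1 ->
  twisting t.
Proof.
move=> Nt t1; pose n w := rho (t^-1 w) ^ t.
have n1 w : n w 1 = w.
  by rewrite /n -{1}t1 permJ rhoE mul1g permKV.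
have nH w : n w \in Hol gT by apply: translate_Hol.
have [g nE] : exists g, forall w, n w = g w * rho w.
  by exists (fun w => n w * (rho w)^-1) => w; rewrite mulgKV.
have gA w : g w \in Aut G.
  apply: Hol_fix1_Aut; first by rewrite -(groupMr _ (rho_Hol w)) -nE.
  by apply: (@perm_inj _ (rho w)); rewrite -permM -nE n1 rhoE mul1g.
have nM x y : n x * n y = n (g y x * y).
  have [z ez] : exists z, n x * n y = n z.
    exists (t (t^-1 x * t^-1 y)); by rewrite /n permK rhoM conjMg.
  have -> : g y x * y = (n x * n y) 1 by rewrite permM n1 nE permM rhoE.
  by rewrite ez n1.
have gn x y : g (g y x * y) = g x * g y.
  apply: (mulIg (rho (g y x * y))); rewrite -nE -nM !nE rhoM.
  by rewrite -(rho_conj_Aut x (gA y)) conjgE !mulgA mulgK.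
have gJ a x : a \in Aut G -> g (a x) = g x ^ a.
  move=> Aa; have [z ez] : exists z, n x ^ a = n z.
    have : rho (t^-1 x) ^ (t * a * t^-1) \in rhoG gT.
      rewrite memJ_norm ?mem_rho //.
      have -> : t * a * t^-1 = a ^ t^-1 by rewrite conjgE invgK mulgA.
      by rewrite -[_ \in 'N(_)]/(_ \in Hol gT) memJ_norm ?groupV ?Aut_Hol.
    case/rhoGP=> y ey; exists (t y); rewrite /n permK -ey -!conjgM.
    by rewrite -mulgA mulVg mulg1.
  have az : z = a x.
    by rewrite -[z]n1 -ez -{1}(morph1 (autm Aa)) /= autmE permJ n1.
  apply: (mulIg (rho (a x))); rewrite -nE -az -ez nE conjMg az.
  by rewrite rho_conj_Aut.
(* Solve g y x' = x in gn and rewrite g x' by equivariance under g y. *)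
have gM x y : g (x * y) = g y * g x.
  have := gn ((g y)^-1 x) y; rewrite permKV => ->.
  by rewrite gJ ?groupV // conjgE invgK -!mulgA mulVg mulg1.
have gZ := equivariant_antimorph_central gA gM gJ.
have [e gE] : exists e, forall x y, g y x = x * e x y.
  by exists (fun x y => x^-1 * g y x) => x y; rewrite mulKVg.
have {}gZ x y : e x y \in Z by have := gZ x y; rewrite gE mulKg.
have eC x y w : e x y * w = w * e x y by apply/centralC/gZ.
have eMl x x' y : e (x * x') y = e x y * e x' y.
  apply: (mulgI (x * x')); rewrite -gE AutM // !gE -!mulgA; congr (_ * _).
  by rewrite !mulgA (eC x y x').
have gZ1 y z : z \in Z -> g y z = z.
  rewrite gE -derZ => Gz.
  by rewrite [e z y](der1_hom_commuting (f := e^~ y)) ?mulg1.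
exists e; last first.
  move=> x y; rewrite -[t x * t y * _]mulgA -eC mulgA -gE -[RHS]rhoE -permM -nE.
  by rewrite /n permJ permK rhoE.
split=> // [x y y' | a x y Aa].
  apply: (mulgI x); rewrite -gE gM permM (gE x y') AutM //.
  by rewrite gE gZ1 ?mulgA ?gZ.
by apply: (mulgI (a x)); rewrite -gE gJ // permJ gE AutM.
Qed.

End Existence.

(** * The sets calS and calS' in terms of defects *)

Lemma twisting_form t : twisting t ->
  exists D, [/\ D \in Bforms gT, rhoG gT :^ t = Nform D, Delta t = Some D
    & forall x y, D (cosetZ (t x), cosetZ (t y)) = defect t x y].
Proof.
case=> e Fe te; have [D BD De] := equiform_Bforms Fe.
have tD : twists (fun x y => D (cosetZ x, cosetZ y)) t.
  by move=> x y; rewrite De te.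
have eN := Nform_twists BD tD; exists D; split=> // [|x y].
  rewrite /Delta eN; case: pickP => [E /andP[BE /eqP eE] | /(_ D)].
    by congr Some; apply: Nform_inj => //; rewrite derZ.
  by rewrite BD eqxx.
by rewrite -(defect_twists x y tD).
Qed.

Definition sym_defect (t : {perm gT}) := forall x y, defect t x y = defect t y x.

Definition antisym_defect (t : {perm gT}) :=
  forall x y, defect t x y = (defect t y x)^-1.

Lemma form_onto (t : {perm gT}) (u : V) : exists x, u = cosetZ (t x).
Proof. by have [x ->] := cosetZ_onto u; exists (t^-1 x); rewrite permKV. Qed.

Lemma Delta_Sforms t : twisting t ->
  oapp (mem (Sforms gT)) false (Delta t) <-> sym_defect t.
Proof.
case/twisting_form=> D [BD _ -> De] /=; rewrite inE BD /=; split=> [sD x y | sd].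
  by have /forallP/(_ (cosetZ (t y)))/eqP := forallP sD (cosetZ (t x)); rewrite !De.
apply/forallP=> u; apply/forallP=> v.
by have [[x ->] [y ->]] := (form_onto t u, form_onto t v); rewrite !De sd.
Qed.

Lemma Delta_S'forms t : twisting t ->
  oapp (mem (S'forms gT)) false (Delta t) <-> antisym_defect t.
Proof.
case/twisting_form=> D [BD _ -> De] /=; rewrite inE BD /=; split=> [sD x y | sd].
  by have /forallP/(_ (cosetZ (t y)))/eqP := forallP sD (cosetZ (t x)); rewrite !De.
apply/forallP=> u; apply/forallP=> v.
by have [[x ->] [y ->]] := (form_onto t u, form_onto t v); rewrite !De sd.
Qed.

Lemma coset_Hol_eq (s t : {perm gT}) : s \in NHol gT -> t \in NHol gT ->
  coset (Hol gT) s = coset (Hol gT) t <-> rhoG gT :^ s = rhoG gT :^ t.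
Proof.
move=> Ns Nt; split=> [/(rcoset_kercosetP Ns Nt)/rcosetP[h Hh ->] | est].
  by rewrite conjsgM (normP Hh).
apply/(rcoset_kercosetP Ns Nt); rewrite mem_rcoset; apply/normP.
by rewrite conjsgM est -conjsgM mulgV conjsg1.
Qed.

(** Precomposing with a translation, an element of Hol(G), changes neither the
    coset nor the conjugate of rho(G). *)
Lemma coset_Hol_fix1 s : s \in NHol gT ->
  exists t : {perm gT}, [/\ t \in NHol gT, t 1 = 1 & rhoG gT :^ t = rhoG gT :^ s].
Proof.
move=> Ns; exists (rho (s^-1 1) * s).
have nH : Hol gT \subset NHol gT by apply: normG.
split; first by rewrite (@groupM _ (NHol_group gT)) // (subsetP nH) ?rho_Hol.
  by rewrite permM rhoE mul1g permKV.
by rewrite conjsgM (normP (rho_Hol _)).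
Qed.

(** * The semidirect decomposition *)

Section Decomposition.

Hypothesis NHol_tw : forall t : {perm gT}, t \in NHol gT -> t 1 = 1 -> twisting t.
Hypothesis oddG : odd #|G|.

Lemma T_P u : u \in T gT <-> exists t : {perm gT},
  [/\ t \in NHol gT, twisting t & u = coset (Hol gT) t].
Proof.
split=> [/morphimP[s _ Ns ->] | [t [Nt _ ->]]]; last exact: mem_quotient.
have [t [Nt t1 et]] := coset_Hol_fix1 Ns.
exists t; split=> //; first exact: NHol_tw.
by apply/esym/coset_Hol_eq.
Qed.

Lemma cal_P (F : {set form gT}) (Q : {perm gT} -> Prop) :
    (forall t, twisting t -> oapp (mem F) false (Delta t) <-> Q t) ->
  forall u, u \in [set coset (Hol gT) t | t in NHol gT &
                                     oapp (mem F) false (Delta t)] <->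
  exists t : {perm gT}, [/\ t \in NHol gT, twisting t, Q t & u = coset (Hol gT) t].
Proof.
move=> FQ u; split=> [/imsetP[s + ->] | [t [Nt Tt Qt ->]]].
  rewrite inE => /andP[Ns Fs]; have [t [Nt t1 et]] := coset_Hol_fix1 Ns.
  have Tt := NHol_tw Nt t1.
  exists t; split=> //; last by apply/esym/coset_Hol_eq.
  by apply/(FQ t Tt); rewrite /Delta et.
by apply/imsetP; exists t; rewrite // inE; apply/andP; split; last apply/(FQ t Tt).
Qed.

Lemma calS_P u : u \in calS gT <-> exists t : {perm gT},
  [/\ t \in NHol gT, twisting t, sym_defect t & u = coset (Hol gT) t].
Proof. exact: (cal_P Delta_Sforms). Qed.

Lemma calS'_P u : u \in calS' gT <-> exists t : {perm gT},
  [/\ t \in NHol gT, twisting t, antisym_defect t & u = coset (Hol gT) t].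
Proof. exact: (cal_P Delta_S'forms). Qed.

Lemma NHol_twistingM s t : s \in NHol gT -> t \in NHol gT ->
  twisting s -> twisting t -> s * t \in NHol gT /\ twisting (s * t).
Proof.
move=> Ns Nt Ts Tt; have Nst : s * t \in NHol gT by apply: groupM.
by split=> //; apply: NHol_tw; rewrite // permM !twisting1.
Qed.

Lemma defect1 x y : defect 1 x y = 1.
Proof. by rewrite /defect !perm1 mulVg. Qed.

Lemma calS_group_set : group_set (calS gT).
Proof.
apply/group_setP; split=> [|_ _ /calS_P[s [Ns Ts Ss ->]] /calS_P[t [Nt Tt St ->]]].
  apply/calS_P; exists 1; split; rewrite ?group1 ?morph1 //.
    by apply: NHol_tw; rewrite ?group1 ?perm1.
  by move=> x y; rewrite !defect1.
have [Nst Tst] := NHol_twistingM Ns Nt Ts Tt.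
apply/calS_P; exists (s * t); split; rewrite ?morphM // => x y.
by rewrite !defect_comp // St Ss.
Qed.

Lemma calS'_group_set : group_set (calS' gT).
Proof.
apply/group_setP; split=> [|_ _ /calS'_P[s [Ns Ts Ss ->]] /calS'_P[t [Nt Tt St ->]]].
  apply/calS'_P; exists 1; split; rewrite ?group1 ?morph1 //.
    by apply: NHol_tw; rewrite ?group1 ?perm1.
  by move=> x y; rewrite !defect1 invg1.
have [Nst Tst] := NHol_twistingM Ns Nt Ts Tt.
apply/calS'_P; exists (s * t); split; rewrite ?morphM // => x y.
rewrite !defect_comp // St Ss twistingV ?twisting_defectZ // [RHS]invMg.
by apply: centralC; rewrite groupV twisting_defectZ.
Qed.

Canonical calS_group := Group calS_group_set.
Canonical calS'_group := Group calS'_group_set.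

Lemma calS_sub : calS gT \subset T gT.
Proof.
by apply/subsetP=> _ /calS_P[t [Nt _ _ ->]]; apply: mem_quotient.
Qed.

Lemma calS'_sub : calS' gT \subset T gT.
Proof.
by apply/subsetP=> _ /calS'_P[t [Nt _ _ ->]]; apply: mem_quotient.
Qed.

(** Raising to the power |G|./2, or one more, acts as -1/2, respectively 1/2,
    in additive notation. *)
Lemma expg_half z : z ^+ (#|G|./2).*2 = z^-1 :> gT.
Proof.
apply: (mulgI z); rewrite mulgV -expgS.
have -> : (#|G|./2).*2.+1 = #|G| by rewrite -{2}(odd_double_half #|G|) oddG.
by rewrite expg_cardG ?inE.
Qed.

Lemma expg_halfS z : z ^+ (#|G|./2).+1.*2 = z :> gT.
Proof. by rewrite doubleS !expgS expg_half mulgV mulg1. Qed.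

(** The quadratic map attached to half the form of s has the same form as s, so
    it conjugates rho(G) to the same regular subgroup and lies in the same
    coset of Hol(G). *)
Lemma calS_quadratic u : u \in calS gT -> exists t : {perm gT},
  [/\ t \in NHol gT, twisting t, sym_defect t, u = coset (Hol gT) t
    & {in Z, forall z, t z = z} /\ forall x, exists2 z, z \in Z & t x = x * z].
Proof.
case/calS_P=> s [Ns Ts Ss ->].
have [e Fe se] := Ts.
have esym x y : e x y = e y x.
  rewrite -[x](permKV s) -[y](permKV s) -!(defect_twists _ _ se); exact: Ss.
have [t [Nt Tt tV tZ td]] := quadratic_twist (#|G|./2).+1 Fe.
have {}td x y : defect t x y = e x y.
  by rewrite td (esym y) -expg2 -expgM mul2n expg_halfS.
exists t; split=> //; first by move=> x y; rewrite !td.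
apply/coset_Hol_eq => //; have [D BD De] := equiform_Bforms Fe.
rewrite (@Nform_twists D s) // ?(@Nform_twists D t) // => x y; rewrite De ?se //.
rewrite defectE td; congr (_ * _).
have [z Zz ->] := tV x; have [w Zw ->] := tV y.
by rewrite (equi_modl _ _ Fe) ?(equi_modr _ _ Fe).
Qed.

(** Take t trivial on Z(G) and G/Z(G).  Comparing the defects of t * s and
    s * t ^ s, the contributions of s cancel because t does not move arguments
    modulo Z(G), which leaves the image under s of the defect of t. *)
Lemma calS_norm : T gT \subset 'N(calS gT).
Proof.
apply/subsetP=> u /T_P[s [Ns Ts ->]]; rewrite inE; apply/subsetP=> us /imsetP[v].
case/calS_quadratic=> t [Nt Tt St -> [tZ tV]] ->.
have Nts : t ^ s \in NHol gT by apply: groupJ.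
have ts1 : (t ^ s) 1 = 1 by rewrite -{1}(twisting1 Ts) permJ !twisting1.
have Tts := NHol_tw Nts ts1.
have tsZ z : z \in Z -> (t ^ s) z = z.
  (* t ^ s is trivial on s @: Z, which is Z by counting. *)
  move=> Zz; have /imsetP[w Zw ->] : z \in s @: Z.
    have /eqP -> // : s @: Z == Z.
    rewrite eqEcard card_imset ?leqnn ?andbT; last exact: perm_inj.
    by apply/subsetP=> _ /imsetP[w Zw ->]; apply: twisting_center.
  by rewrite permJ tZ.
apply/calS_P; exists (t ^ s); split=> //; last by rewrite morphJ.
have dts x y : defect (t ^ s) (s x) (s y) = s (defect t x y).
  have := defect_comp x y Ts Tts; rewrite -conjgC defect_comp //.
  have [z Zz ->] := tV x; have [w Zw ->] := tV y.
  rewrite twisting_defect_mod // tsZ ?twisting_defectZ // => e.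
  apply: (mulgI (defect s x y)); rewrite e; apply/esym/centralC.
  exact: twisting_defectZ.
by move=> x y; rewrite -[x](permKV s) -[y](permKV s) !dts St.
Qed.

Lemma calS_calS'_trivg : calS gT :&: calS' gT = 1.
Proof.
apply/trivgP/subsetP=> _ /setIP[/calS_P[s [Ns Ts Ss ->]] /calS'_P[t [Nt Tt At]]].
case/(coset_Hol_eq Ns Nt) => est; rewrite inE; apply/eqP/coset_id.
have [D [BD sD _ De]] := twisting_form Ts; have [E [BE tE _ Ee]] := twisting_form Tt.
have eDE : D = E by apply: Nform_inj; rewrite ?derZ // -sD -tE.
apply/Aut_Hol/defect_eq1_Aut => x y.
have ds : defect s x y = (defect s x y)^-1.
  have [x' ex] := form_onto t (cosetZ (s x)).
  have [y' ey] := form_onto t (cosetZ (s y)).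
  by rewrite {2}Ss -!De ex ey eDE !Ee; apply: At.
by rewrite -(expg_halfS (defect s x y)) -mul2n expgM expg2 {1}ds mulVg expg1n.
Qed.

(** Multiplying s on the right by the quadratic map t for k = -1/2, which has
    symmetric defect, subtracts the symmetric part of the form of s. *)
Lemma T_decomp u : u \in T gT -> u \in calS' gT * calS gT.
Proof.
case/T_P=> s [Ns Ts ->]; have [e Fe se] := Ts.
have [t [Nt Tt _ tZ td]] := quadratic_twist #|G|./2 Fe.
have [Nst Tst] := NHol_twistingM Ns Nt Ts Tt.
apply/mulsgP; exists (coset (Hol gT) (s * t)) (coset (Hol gT) t)^-1; last first.
- by rewrite morphM // mulgK.
- rewrite (@groupV _ calS_group); apply/calS_P; exists t; split=> // x y.
  by rewrite !td; congr (_ ^+ _); apply: equi_commute.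
apply/calS'_P; exists (s * t); split=> // x y.
rewrite !defect_comp // !td !tZ ?twisting_defectZ // !(defect_twists _ _ se).
set a := e _ _; set b := e _ _.
have Ca w : a * w = w * a by apply/centralC/(equi_center Fe).
rewrite -(Ca b); apply: (mulIg ((a * b) ^+ #|G|./2 * b)).
rewrite mulVg -mulgA (Ca (_ ^+ _ * _)) !mulgA -expgD addnn expg_half.
by rewrite -mulgA -(Ca b) mulVg.
Qed.

Lemma calS_sdprod : calS gT ><| calS' gT = T gT.
Proof.
have nSS' : calS' gT \subset 'N(calS gT) := subset_trans calS'_sub calS_norm.
rewrite (@sdprodE _ calS_group calS'_group) ?calS_calS'_trivg //.
apply/eqP; rewrite eqEsubset (@mul_subG _ (T_group gT)) ?calS_sub ?calS'_sub //=.
by rewrite -(normC nSS'); apply/subsetP=> u; apply: T_decomp.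
Qed.

End Decomposition.

End Forms.

Theorem proposition2p8 (gT : finGroupType) (p : nat)
    (p_pr : prime p) (p_odd : odd p)
    (pG : p.-group [set: gT])
    (class2 : nil_class [set: gT] = 2)
    (derZ : [set: gT]^`(1) = 'Z([set: gT]))
    (no_equiv : forall g : {morphism ([set: gT] / 'Z([set: gT])) >->
                              {perm coset_of 'Z([set: gT])}},
       g @* ([set: gT] / 'Z([set: gT])) \subset AutC gT ->
       equivariant g ->
       forall v : coset_of 'Z([set: gT]), g v = 1) :
  calS gT <| T gT /\ calS gT ><| calS' gT = T gT.
Proof.
have NHol_tw := NHol_twisting derZ no_equiv.
have oddG : odd #|[set: gT]| by apply: odd_pgroup_odd p_odd pG.
split; last exact: calS_sdprod.
by apply/andP; split; [apply: calS_sub | apply: calS_norm].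
Qed.
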